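(* For formulas $\varphi,\psi$ the following are equivalent: (1) $\varphi\vdash\psi$ is valid in all ortholattices and in all Heyting lattices; (2) $\varphi\vdash\psi$ is valid in all Ex-lattices. Consequently, the intersection of orthologic and the implication-free fragment of intuitionistic logic is exactly fundamental logic extended by the axiom (Ex).
   Context: Formulas are built from propositional variables and $\top,\bot$ using $\wedge,\vee,\lnot$ (no implication). A fundamental lattice is a bounded lattice with a unary $\lnot$ that is antitone, satisfies $a\wedge\lnot a=0$ and $a\le\lnot\lnot a$. An entailment $\varphi\vdash\psi$ is valid in $L$ if $v(\varphi)\le v(\psi)$ for every valuation $v$ (homomorphic extension of an assignment of elements of $L$ to variables, with $\top\mapsto1,\bot\mapsto0$). An ortholattice is a fundamental lattice with $\lnot\lnot a=a$; orthologic is the set of entailments valid in all ortholattices. A Heyting lattice is a distributive fundamental lattice with $a\wedge b=0\Rightarrow b\le\lnot a$; the implication-free fragment of intuitionistic logic is the set of entailments valid in all Heyting lattices. The axiom (Ex) is $\lnot\big[a\wedge((b\wedge c)\vee(b\wedge d))\big]\wedge a\wedge(c\vee e)\wedge\lnot\lnot f \vdash \lnot\lnot(a\wedge f)\wedge\big[(a\wedge c)\vee(a\wedge e)\vee f\big]\wedge\big[(b\wedge(c\vee d))\vee\lnot(b\wedge(c\vee d))\big]$; an Ex-lattice is a fundamental lattice in which (Ex) is valid. Fundamental logic extended by (Ex) is the set of entailments valid in all Ex-lattices (equivalently, the closure of fundamental logic, the smallest logic with introduction/elimination rules for $\wedge,\vee,\lnot$, under this axiom). *)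

(* Defs.v *)
From mathcomp Require Import all_boot all_order.
From mathcomp Require Import boolp classical_sets.

Set Implicit Arguments.
Unset Strict Implicit.
Unset Printing Implicit Defensive.

Import Order.TTheory.
Local Open Scope order_scope.

Inductive formula : Type :=
  | Var of nat
  | Top
  | Bot
  | And of formula & formula
  | Or of formula & formula
  | Neg of formula.

Declare Scope formula_scope.
Delimit Scope formula_scope with F.
Bind Scope formula_scope with formula.

Notation "p ∧ q" := (And p q) (at level 40, left associativity) : formula_scope.
Notation "p ∨ q" := (Or p q) (at level 50, left associativity) : formula_scope.
Notation "¬ p" := (Neg p) (at level 35, right associativity) : formula_scope.

(* The pair (p, q) stands for the entailment p |- q. *)
Definition entailment : Type := (formula * formula)%type.

(* A lattice with negation is a pair (L, neg) with L : tbLatticeType d. The     *)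
(* order of L is boolean and its carrier is a choiceType; with the axioms of    *)
(* boolp, every bounded lattice can be given this structure, so quantifying     *)
(* over all L : tbLatticeType d ranges over all bounded lattices (including     *)
(* the one-element lattice, where \bot = \top).                                 *)

Record fundamental d (L : tbLatticeType d) (neg : L -> L) : Prop := Fundamental {
  fundamental_anti : forall a b : L, a <= b -> neg b <= neg a;
  fundamental_meetN : forall a : L, a `&` neg a = \bot;
  fundamental_le_negK : forall a : L, a <= neg (neg a)
}.

Record orthocomplemented d (L : tbLatticeType d) (neg : L -> L) : Prop :=
  Orthocomplemented {
  ortho_fundamental : fundamental neg;
  ortho_negK : involutive neg
}.

(* Distributivity comes from the type of L. *)
Record heyting d (L : tbDistrLatticeType d) (neg : L -> L) : Prop := Heyting {
  heyting_fundamental : fundamental neg;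
  heyting_pseudo : forall a b : L, a `&` b = \bot -> b <= neg a
}.

Fixpoint eval d (L : tbLatticeType d) (neg : L -> L) (v : nat -> L)
    (p : formula) : L :=
  match p with
  | Var n => v n
  | Top => \top
  | Bot => \bot
  | And p1 p2 => eval neg v p1 `&` eval neg v p2
  | Or p1 p2 => eval neg v p1 `|` eval neg v p2
  | Neg p1 => neg (eval neg v p1)
  end.

Definition valid_in d (L : tbLatticeType d) (neg : L -> L) (e : entailment) :
    Prop :=
  forall v : nat -> L, eval neg v e.1 <= eval neg v e.2.

Definition Ex : entailment :=
  let a := Var 0 in let b := Var 1 in let c := Var 2 in
  let d := Var 3 in let e := Var 4 in let f := Var 5 in
  ((¬ (a ∧ ((b ∧ c) ∨ (b ∧ d))) ∧ a ∧ (c ∨ e) ∧ ¬ ¬ f)%F,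
   (¬ ¬ (a ∧ f) ∧ ((a ∧ c) ∨ (a ∧ e) ∨ f)
      ∧ ((b ∧ (c ∨ d)) ∨ ¬ (b ∧ (c ∨ d))))%F).

Record Ex_lattice d (L : tbLatticeType d) (neg : L -> L) : Prop := ExLattice {
  Ex_fundamental : fundamental neg;
  Ex_valid : valid_in neg Ex
}.

Definition valid_ortholattices (e : entailment) : Prop :=
  forall (d : Order.disp_t) (L : tbLatticeType d) (neg : L -> L),
    orthocomplemented neg -> valid_in neg e.

Definition valid_heyting_lattices (e : entailment) : Prop :=
  forall (d : Order.disp_t) (L : tbDistrLatticeType d) (neg : L -> L),
    heyting neg -> valid_in neg e.

Definition valid_Ex_lattices (e : entailment) : Prop :=
  forall (d : Order.disp_t) (L : tbLatticeType d) (neg : L -> L),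
    Ex_lattice neg -> valid_in neg e.

Definition orthologic : set entailment :=
  [set e | valid_ortholattices e]%classic.

Definition intuitionistic_fragment : set entailment :=
  [set e | valid_heyting_lattices e]%classic.

Definition fundamental_logic_Ex : set entailment :=
  [set e | valid_Ex_lattices e]%classic.

(* Main.v *)
(* (Ex) packs three principles: [~~] preserves meets; the inequality
   [a /\ (y \/ z) <= (a /\ y) \/ (a /\ z) \/ b] holds whenever [a <= ~~b]; and
   [~(a /\ ((b /\ y) \/ (b /\ z))) /\ a <= x \/ ~x] for [x = b /\ (y \/ z)].
   By the first, [x |-> ~~x] is a homomorphism from an Ex-lattice [L] onto the
   ortholattice of its regular elements. By the third, [x |-> {P | x \in P}] is a
   homomorphism into the Heyting lattice of up-sets of prime filters of [L].
   Suppose [a <= b] fails. Either [~~a <= ~~b] fails, and the first map separates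
   [a] from [b], or [a <= ~~b], and the second principle yields a prime filter
   containing [a] but not [b], so that the second map does. *)
Require Import Defs.
From HB Require Import structures.
From mathcomp Require Import all_boot all_order.
From mathcomp Require Import boolp classical_sets.

Set Implicit Arguments.
Unset Strict Implicit.
Unset Printing Implicit Defensive.

Import Order.TTheory.
Local Open Scope order_scope.

(** * Negation in fundamental lattices *)

Section FundamentalTheory.
Context d (L : tbLatticeType d) (neg : L -> L).
Hypothesis fneg : fundamental neg.
Implicit Types a b x y : L.

Lemma neg_anti a b : a <= b -> neg b <= neg a.
Proof. exact: (fundamental_anti fneg). Qed.

Lemma le_negneg a : a <= neg (neg a).
Proof. exact: (fundamental_le_negK fneg). Qed.

Lemma meetxN a : a `&` neg a = \bot.
Proof. exact: (fundamental_meetN fneg). Qed.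

Lemma negneg_mono a b : a <= b -> neg (neg a) <= neg (neg b).
Proof. by move=> /neg_anti/neg_anti. Qed.

Lemma negK3 a : neg (neg (neg a)) = neg a.
Proof. by apply/le_anti; rewrite neg_anti ?le_negneg. Qed.

Lemma neg_top : neg \top = \bot.
Proof. by rewrite -(meetxN \top) meet1x. Qed.

Lemma neg_bot : neg \bot = \top.
Proof. by apply/eqP; rewrite -le1x -neg_top le_negneg. Qed.

(** Antitonicity and [a <= neg (neg a)] make [neg] a Galois connection with itself, so it turns
    joins into meets. *)
Lemma neg_join a b : neg (a `|` b) = neg a `&` neg b.
Proof.
apply/le_anti; rewrite lexI !neg_anti ?leUl ?leUr //=.
apply: le_trans (le_negneg _) (neg_anti _); rewrite leUx.
by apply/andP; split; apply: le_trans (le_negneg _) (neg_anti _);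
  rewrite ?leIl ?leIr.
Qed.

End FundamentalTheory.

(** * Homomorphisms of lattices with negation *)

Section Homomorphism.
Context d1 d2 (L1 : tbLatticeType d1) (L2 : tbLatticeType d2).
Context (neg1 : L1 -> L1) (neg2 : L2 -> L2).

Record lattice_neg_hom (h : L1 -> L2) : Prop := LatticeNegHom {
  homT : h \top = \top;
  homB : h \bot = \bot;
  homI : {morph h : x y / x `&` y};
  homU : {morph h : x y / x `|` y};
  homN : {morph h : x / neg1 x >-> neg2 x}
}.

Lemma eval_hom h v p : lattice_neg_hom h ->
  h (eval neg1 v p) = eval neg2 (h \o v) p.
Proof.
move=> [hT hB hI hU hN].
by elim: p => //= [p <- q <-|p <- q <-|p <-]; rewrite ?hI ?hU ?hN.
Qed.

End Homomorphism.

(** * The ortholattice of regular elements *)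

Section Regular.
Context d (L : tbLatticeType d) (neg : L -> L) (fneg : fundamental neg).
Implicit Types x y z : L.

(** The proof of [fundamental neg] is a parameter of the type so that the instances below, which
    depend on it, can be inferred from the type. *)
Definition regular of fundamental neg : Type := {x : L | neg (neg x) == x}.
Local Notation reg := (regular fneg).

HB.instance Definition _ := [isSub of reg for @sval L _].
HB.instance Definition _ := [Choice of reg by <:].
HB.instance Definition _ := [SubChoice_isSubPOrder of reg by <: with d].

Lemma le_val_regular (x y : reg) : (x <= y) = (val x <= val y).
Proof. by []. Qed.

Fact negneg_regular x : neg (neg (neg (neg x))) == neg (neg x).
Proof. by rewrite negK3. Qed.

Definition to_regular x : reg := exist _ (neg (neg x)) (negneg_regular x).

Lemma val_to_regular x : val (to_regular x) = neg (neg x).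
Proof. by []. Qed.

Lemma regularP (x : reg) : neg (neg (val x)) = val x.
Proof. exact/eqP/(valP x). Qed.

Definition regular_meet (x y : reg) : reg := to_regular (val x `&` val y).
Definition regular_join (x y : reg) : reg := to_regular (val x `|` val y).
Definition regular_neg (x : reg) : reg := to_regular (neg (val x)).

(** Double negation is a closure operator, so [to_regular] is left adjoint to the inclusion; joins
    of regular elements are closures of joins in [L]. *)
Lemma to_regular_le x (y : reg) : (to_regular x <= y) = (x <= val y).
Proof.
rewrite le_val_regular val_to_regular; apply/idP/idP.
  exact/le_trans/le_negneg.
by rewrite -{2}regularP; exact: negneg_mono.
Qed.

Lemma val_regular_meet (x y : reg) : val (regular_meet x y) = val x `&` val y.
Proof.
rewrite val_to_regular; apply/le_anti; rewrite (le_negneg fneg) andbT lexI.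
rewrite -{2}(regularP x) -{3}(regularP y).
by rewrite !(negneg_mono fneg) ?leIl ?leIr.
Qed.

Fact regular_meetP (x y z : reg) :
  (x <= regular_meet y z) = (x <= y) && (x <= z).
Proof. by rewrite !le_val_regular val_regular_meet lexI. Qed.

Fact regular_joinP (x y z : reg) :
  (regular_join x y <= z) = (x <= z) && (y <= z).
Proof. by rewrite to_regular_le leUx. Qed.

HB.instance Definition _ :=
  Order.POrder_MeetJoin_isLattice.Build d reg regular_meetP regular_joinP.

Fact regular_le0x (x : reg) : to_regular \bot <= x.
Proof. by rewrite to_regular_le le0x. Qed.

Fact regular_lex1 (x : reg) : x <= to_regular \top.
Proof. by rewrite le_val_regular val_to_regular (le_trans (lex1 _)) ?le_negneg. Qed.

HB.instance Definition _ := Order.hasBottom.Build d reg regular_le0x.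
HB.instance Definition _ := Order.hasTop.Build d reg regular_lex1.

Lemma val_regular_neg (x : reg) : val (regular_neg x) = neg (val x).
Proof. by rewrite val_to_regular negK3. Qed.

Lemma regular_orthocomplemented : orthocomplemented regular_neg.
Proof.
have negK : involutive regular_neg.
  by move=> x; apply/val_inj; rewrite !val_regular_neg regularP.
split=> //; split=> [a b|a|a]; last by rewrite negK.
- by rewrite !le_val_regular !val_regular_neg; exact: neg_anti.
- apply/val_inj; rewrite val_regular_meet val_regular_neg meetxN //.
  by rewrite val_to_regular neg_bot ?neg_top.
Qed.

(** Joins are preserved in every fundamental lattice, by De Morgan and triple negation; the
    hypothesis provides the preservation of meets. *)
Lemma to_regular_hom :
    (forall x y, neg (neg x) `&` neg (neg y) <= neg (neg (x `&` y))) ->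
  lattice_neg_hom neg regular_neg to_regular.
Proof.
move=> nnI; split=> // [x y|x y|x]; apply/val_inj.
- rewrite val_regular_meet !val_to_regular; apply/le_anti; rewrite nnI lexI.
  by rewrite !negneg_mono ?leIl ?leIr.
- by rewrite !val_to_regular !(neg_join fneg) !negK3.
- by rewrite val_regular_neg !val_to_regular.
Qed.

End Regular.

(** * The Heyting lattice of up-sets of a poset *)

Section Upset.
Context d (T : porderType d).
Implicit Types x y : T.

Definition upclosed : {pred set T} :=
  fun U => `[< forall x y, x <= y -> U x -> U y >].

Lemma upclosedP U :
  reflect (forall x y, x <= y -> U x -> U y) (U \in upclosed).
Proof. exact: asboolP. Qed.

Fact upclosedI : {in upclosed &, forall U V, U `&` V \in upclosed}.
Proof.
move=> U V /upclosedP uU /upclosedP uV; apply/upclosedP => x y xy [Ux Vx].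
by split; [exact: uU Ux|exact: uV Vx].
Qed.

Fact upclosedU : {in upclosed &, forall U V, U `|` V \in upclosed}.
Proof.
move=> U V /upclosedP uU /upclosedP uV; apply/upclosedP => x y xy [Ux|Vx].
  by left; exact: uU Ux.
by right; exact: uV Vx.
Qed.

Fact upclosed0 : \bot \in upclosed. Proof. exact/upclosedP. Qed.
Fact upclosed1 : \top \in upclosed. Proof. exact/upclosedP. Qed.

HB.instance Definition _ := Order.isTBLatticeClosed.Build _ _ upclosed
  upclosedI upclosedU upclosed0 upclosed1.

Definition upset : Type := {U : set T | U \in upclosed}.

HB.instance Definition _ := [isSub of upset for @sval _ _].
HB.instance Definition _ := [Choice of upset by <:].
HB.instance Definition _ := 
  [SubChoice_isTBSubLattice of upset by <: with set_display].

Lemma val_upsetI (U V : upset) : val (U `&` V) = val U `&` val V.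
Proof. by []. Qed.

Lemma val_upsetU (U V : upset) : val (U `|` V) = val U `|` val V.
Proof. by []. Qed.

Fact upset_meetUl :
  @left_distributive upset upset (@Order.meet _ upset) (@Order.join _ upset).
Proof.
by move=> U V W; apply/val_inj; rewrite val_upsetI !val_upsetU !val_upsetI meetUl.
Qed.

HB.instance Definition _ :=
  Order.Lattice_Meet_isDistrLattice.Build _ upset upset_meetUl.

Lemma upset_leP (U V : upset) : reflect (forall x, val U x -> val V x) (U <= V).
Proof. exact: asboolP. Qed.

Lemma upset_eqP (U V : upset) : (forall x, val U x <-> val V x) -> U = V.
Proof. by move=> UV; apply/val_inj/seteqP; split=> x /UV. Qed.

Fact upset_neg_upclosed (U : upset) :
  (fun x => forall y, x <= y -> ~ val U y) \in upclosed.
Proof.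
by apply/upclosedP => x y xy nU z yz; apply: nU; exact: le_trans yz.
Qed.

(** This is the negation of Kripke semantics: the largest up-set disjoint from [U]. *)
Definition upset_neg (U : upset) : upset :=
  @exist (set T) (fun V => V \in upclosed) _ (upset_neg_upclosed U).

Lemma upset_heyting : heyting upset_neg.
Proof.
have upU (U : upset) x y : x <= y -> val U x -> val U y.
  by move: x y; exact/upclosedP/(valP U).
split; first split.
- move=> U V /upset_leP UV; apply/upset_leP => x nV y xy /UV; exact: nV.
- by move=> U; apply: upset_eqP => x; split=> // -[Ux /(_ x (lexx x))].
- by move=> U; apply/upset_leP => x Ux y xy /(_ y (lexx y)); apply; exact: upU Ux.
move=> U V UV0; apply/upset_leP => x Vx y xy Uy.
have : val (U `&` V) y by rewrite val_upsetI; split=> //; exact: upU Vx.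
by rewrite UV0.
Qed.

End Upset.

(** * Prime filters, separation and the spectrum *)

Section PrimeFilters.
Context d (L : tbLatticeType d).
Implicit Types (x y z : L) (F P : set L).

Record lattice_filter F : Prop := LatticeFilter {
  filter_top : F \top;
  filter_up : forall x y, x <= y -> F x -> F y;
  filter_meet : forall x y, F x -> F y -> F (x `&` y)
}.

Record prime_filter P : Prop := PrimeFilter {
  prime_is_filter : lattice_filter P;
  prime_bot : ~ P \bot;
  prime_join : forall x y, P (x `|` y) -> P x \/ P y
}.

(** Two elements of the union lie in a common [F] ∪ [A], since [C] is a chain. Adjoining [F] covers
    the empty chain, whose union alone is not a filter. *)
Lemma filter_bigcup F (C : set (set L)) :
    lattice_filter F -> (forall A, C A -> lattice_filter (F `|` A)%classic) ->
    total_on C subset ->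
  lattice_filter (F `|` \bigcup_(A in C) A)%classic.
Proof.
move=> filF filC totC.
have sub A : C A -> (F `|` A `<=` F `|` \bigcup_(B in C) B)%classic.
  by move=> CA; apply: setUS; exact: bigcup_sup.
have common x y : (F `|` \bigcup_(A in C) A)%classic x ->
    (F `|` \bigcup_(A in C) A)%classic y ->
  (F x /\ F y) \/ (exists2 A, C A & (F `|` A)%classic x /\ (F `|` A)%classic y).
  move=> [Fx|[A CA Ax]] [Fy|[B CB By]]; first by left.
  - by right; exists B => //; split; [left|right].
  - by right; exists A => //; split; [right|left].
  - have [AB|BA] := totC _ _ CA CB; right.
      by exists B => //; split; right=> //; exact: AB.
    by exists A => //; split; right=> //; exact: BA.
split; first by left; exact: filter_top.
  move=> x y xy Ux; have [[Fx _]|[A CA [Ax _]]] := common _ _ Ux Ux.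
    by left; exact: filter_up Fx.
  by apply: (sub A CA); exact: (filter_up (filC A CA)) Ax.
move=> x y Ux Uy; have [[Fx Fy]|[A CA [Ax Ay]]] := common _ _ Ux Uy.
  by left; exact: filter_meet.
by apply: (sub A CA); exact: (filter_meet (filC A CA)).
Qed.

(* The last hypothesis on [I] is weaker than distributivity of [L]: it only
   asks that, for every [x], the elements [y] with [x `&` y] in [I] be closed
   under joins. *)
Lemma prime_filter_separation F (I : set L) :
    lattice_filter F -> I \bot -> (forall x, F x -> ~ I x) ->
    (forall x y, x <= y -> I y -> I x) ->
    (forall x y z, I (x `&` y) -> I (x `&` z) -> I (x `&` (y `|` z))) ->
  exists P, [/\ prime_filter P, (F `<=` P)%classic & forall x, P x -> ~ I x].
Proof.
move=> filF I0 FI Idown Ijoin.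
(* Zorn's lemma is applied to sets [A] that become filters once [F] is adjoined, so that the empty
   chain also has its union in [ok]. *)
pose ok (A : set L) : Prop :=
  lattice_filter (F `|` A)%classic /\ forall x, A x -> ~ I x.
have [|A [[filP AI] Amax]] := @Zorn_bigcup L ok.
  move=> C okC totC; split; last by move=> x [A /okC [_]]; exact.
  by apply: filter_bigcup => // A /okC [].
set P := (F `|` A)%classic in filP.
have PI x : P x -> ~ I x by move=> [/FI|/AI].
(* By maximality, the filter [B] generated by [P] and an element [y] outside [P] must hit [I]. *)
have meets y : ~ P y -> exists2 q, P q & I (q `&` y).
  move=> Py; apply: contrapT => nI.
  pose B : set L := fun u => exists2 q, P q & q `&` y <= u.
  have PB x : P x -> B x by move=> Px; exists x => //; exact: leIl.
  have BE : (F `|` B)%classic = B by apply/setUidPr => x Fx; apply: PB; left.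
  have AB : (A `<` B)%classic.
    split; first by move=> x Ax; apply: PB; right.
    move=> /(_ y) BA; apply: Py; right; apply: BA.
    by exists \top; [exact: filter_top|exact: leIr].
  apply: (Amax B AB); split; last first.
    by move=> x [q Pq qx] Ix; apply: nI; exists q => //; exact: Idown Ix.
  rewrite BE; split; first by apply: PB; exact: filter_top.
    by move=> u v uv [q Pq qu]; exists q => //; exact: le_trans uv.
  move=> u v [q Pq qu] [r Pr rv]; exists (q `&` r); first exact: filter_meet.
  rewrite lexI (le_trans _ qu) ?(le_trans _ rv) //.
    by rewrite leI2 ?leIr.
  by rewrite leI2 ?leIl.
exists P; split; [split=> // | by left | by []].
  by move=> /PI.
(* If neither [y] nor [z] is in [P], the witnesses [q] and [r] combine: the meet of [q], [r] and [y]
   ∨ [z] is in [P], and in [I] by [Ijoin]. *)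
move=> y z Pyz; apply: contrapT => /not_orP [/meets [q Pq Iqy] /meets [r Pr Irz]].
apply: (PI (q `&` r `&` (y `|` z))); first by do !apply: filter_meet.
by apply: Ijoin; [apply: Idown Iqy|apply: Idown Irz]; rewrite leI2 ?leIl ?leIr.
Qed.

Definition spectrum : Type := {P : set L | P \in (prime_filter : set (set L))}.

HB.instance Definition _ := [isSub of spectrum for @sval _ _].
HB.instance Definition _ := [Choice of spectrum by <:].
HB.instance Definition _ :=
  [SubChoice_isSubPOrder of spectrum by <: with set_display].

Definition to_spectrum P (pP : prime_filter P) : spectrum :=
  @exist (set L) (fun Q => Q \in (prime_filter : set (set L))) P (mem_set pP).

Lemma spectrumP (P : spectrum) : prime_filter (val P).
Proof. exact/set_mem/(valP P). Qed.

Lemma spectrum_leP (P Q : spectrum) :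
  reflect (forall x, val P x -> val Q x) (P <= Q).
Proof. exact: asboolP. Qed.

Fact basic_upset_upclosed x :
  (fun P : spectrum => val P x) \in @upclosed _ spectrum.
Proof. by apply/upclosedP => P Q /spectrum_leP; exact. Qed.

Definition basic_upset x : upset spectrum :=
  @exist (set spectrum) (fun U => U \in @upclosed _ spectrum) _
    (basic_upset_upclosed x).

(** Primeness gives joins and properness gives [\bot]. The extension hypothesis is for negation: a
    point without [neg x] must lie below a point containing [x]. *)
Lemma basic_upset_hom (neg : L -> L) :
    (forall x, x `&` neg x = \bot) ->
    (forall P x, prime_filter P -> ~ P (neg x) ->
      exists Q, [/\ prime_filter Q, (P `<=` Q)%classic & Q x]) ->
  lattice_neg_hom neg (@upset_neg _ spectrum) basic_upset.
Proof.
move=> xN ext; split=> [||x y|x y|x]; apply: upset_eqP => P;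
  have [filP P0 Pjoin] := spectrumP P.
- by split=> // _; exact: (filter_top filP).
- by split=> // /P0.
- rewrite val_upsetI; split=> [Pxy|[Px Py]]; last exact: (filter_meet filP).
  by split; apply: (filter_up filP) Pxy; rewrite ?leIl ?leIr.
- rewrite val_upsetU; split=> [/Pjoin //|].
  by case; apply: (filter_up filP); rewrite ?leUl ?leUr.
split=> [Px Q /spectrum_leP PQ Qx|nx].
  have [filQ Q0 _] := spectrumP Q.
  by apply: Q0; rewrite -(xN x); apply: (filter_meet filQ) => //; exact: PQ.
apply: contrapT => Px; have [Q [pQ PQ Qx]] := ext _ _ (spectrumP P) Px.
apply: (nx (to_spectrum pQ)) Qx; exact/spectrum_leP.
Qed.

End PrimeFilters.

(** * Consequences of (Ex) and prime filters in Ex-lattices *)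

Section ExLattice.
Context d (L : tbLatticeType d) (neg : L -> L) (exL : Ex_lattice neg).
Implicit Types a b c x y z : L.

Let fneg : fundamental neg := Ex_fundamental exL.

Lemma Ex_inequality a b c d' e f :
  neg (a `&` ((b `&` c) `|` (b `&` d'))) `&` a `&` (c `|` e) `&` neg (neg f) <=
  neg (neg (a `&` f)) `&` ((a `&` c) `|` (a `&` e) `|` f)
    `&` ((b `&` (c `|` d')) `|` neg (b `&` (c `|` d'))).
(* The list is the valuation of the six variables; variables beyond them get the default [\bot]. *)
Proof. exact: (Ex_valid exL (nth \bot [:: a; b; c; d'; e; f])). Qed.

Lemma Ex_le_negneg_meet a f : a `&` neg (neg f) <= neg (neg (a `&` f)).
Proof.
have := Ex_inequality a \bot \top \bot \bot f.
rewrite !meet0x joinxx meetx0 (neg_bot fneg) meet1x joinx0 meetx1 => h.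
by apply: le_trans h _; rewrite -meetA leIl.
Qed.

(** The one-sided inequality is used twice, first with [neg (neg a)] for [a], then under a double
    negation with the factors swapped; four negations collapse to two. *)
Lemma Ex_negneg_meet a b :
  neg (neg a) `&` neg (neg b) <= neg (neg (a `&` b)).
Proof.
apply: le_trans (Ex_le_negneg_meet _ _) _.
rewrite -[leRHS](negK3 fneg) (negneg_mono fneg) // meetC [a `&` b]meetC.
exact: Ex_le_negneg_meet.
Qed.

Lemma Ex_distributive_over a b y z : a <= neg (neg b) ->
  a `&` (y `|` z) <= (a `&` y) `|` (a `&` z) `|` b.
Proof.
move=> ab; have := Ex_inequality a \bot y \bot z b.
rewrite !meet0x joinxx meetx0 (neg_bot fneg) meet1x meetAC (meet_idPl ab) => h.
by apply: le_trans h _; rewrite -meetA (le_trans (leIr _ _)) ?leIl.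
Qed.

Lemma Ex_complement a b y z :
  neg (a `&` ((b `&` y) `|` (b `&` z))) `&` a <=
  (b `&` (y `|` z)) `|` neg (b `&` (y `|` z)).
Proof.
have := Ex_inequality a b y z \top \top.
rewrite (neg_top fneg) (neg_bot fneg) joinx1 !meetx1 => h.
by apply: le_trans h _; rewrite leIr.
Qed.

Lemma Ex_prime_separation a b : a <= neg (neg b) -> ~ a <= b ->
  exists P, [/\ prime_filter P, P a & ~ P b].
Proof.
move=> ann nab.
(* The filter is generated by [a]. Taking [a] ∧ [u] in the ideal keeps every meet to be distributed
   below [a], hence below [neg (neg b)], as [Ex_distributive_over] requires. *)
have [| | | | |P [pP FP PI]] :=
    @prime_filter_separation _ L (fun u => a <= u) (fun u => a `&` u <= b).
- split=> [|x y xy ax|x y ax ay]; first exact: lex1.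
    exact: le_trans xy.
  by rewrite lexI ax.
- by rewrite meetx0 le0x.
- by move=> x ax; rewrite (meet_idPl ax).
- by move=> x y xy; apply: le_trans; rewrite leI2.
- move=> x y z; rewrite !meetA => xy xz.
  have := @Ex_distributive_over (a `&` x) b y z.
  rewrite (le_trans (leIl _ _) ann) => /(_ isT) /le_trans; apply.
  by rewrite !leUx xy xz lexx.
exists P; split=> //; first by apply: FP; exact: lexx.
by move=> /PI; rewrite leIr.
Qed.

(* A filter disjoint from the ideal [{u | neg u \in P}], rather than merely
   proper, is what (Ex) allows one to extend to a prime filter. *)
Lemma Ex_prime_extension P x : prime_filter P -> ~ P (neg x) ->
  exists Q, [/\ prime_filter Q, (P `<=` Q)%classic & Q x].
Proof.
move=> [filP P0 Pjoin] Pnx.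
have Pup u v : u <= v -> P u -> P v by exact: (filter_up filP).
have PI u v : P u -> P v -> P (u `&` v) by exact: (filter_meet filP).
have cons u : P u -> ~ P (neg u).
  by move=> Pu Pnu; apply: P0; rewrite -(meetxN fneg u); exact: PI.
have [| | | | |Q [pQ FQ _]] := @prime_filter_separation _ L
    (fun u => exists2 p, P p & p `&` x <= u) (fun u => P (neg u)).
- split=> [|u v uv [p Pp pu]|u v [p Pp pu] [q Pq qv]].
  + by exists \top; [exact: (filter_top filP)|exact: lex1].
  + by exists p => //; exact: le_trans uv.
  + exists (p `&` q); first exact: PI.
    rewrite lexI (le_trans _ pu) ?(le_trans _ qv) //.
      by rewrite leI2 ?leIr.
    by rewrite leI2 ?leIl.
- by rewrite (neg_bot fneg); exact: (filter_top filP).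
(* Disjointness: with [\top] for [y] and [z], [Ex_complement] puts [x] ∨ [neg x] in [P]. Primeness
   then yields [x], so [P] contains both [p] ∧ [x] and its negation. *)
- move=> u [p Pp pxu] Pnu; have {}Pnu := Pup _ _ (neg_anti fneg pxu) Pnu.
  have := Ex_complement p x \top \top; rewrite !joinxx !meetx1.
  move=> /Pup /(_ (PI _ _ Pnu Pp)) /Pjoin [Px|//].
  by apply: (cons (p `&` x)) => //; exact: PI.
- by move=> u v uv; apply: Pup; exact: (neg_anti fneg).
(* Closure under joins: [P] contains [u] ∧ ([y] ∨ [z]) or its negation. In the first case primeness
   puts [y] or [z] in [P], hence also a meet whose negation is in [P]. *)
- move=> u y z Py Pz; have := Ex_complement \top u y z.
  rewrite meet1x meetx1 (neg_join fneg) => /Pup /(_ (PI _ _ Py Pz)) /Pjoin [|//].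
  move=> Pu; have /Pjoin [Pz'|Pz'] : P (y `|` z) by apply: Pup Pu; exact: leIr.
    by case: (cons (u `&` y)) => //; apply: PI => //; apply: Pup Pu; exact: leIl.
  by case: (cons (u `&` z)) => //; apply: PI => //; apply: Pup Pu; exact: leIl.
exists Q; split=> //; last first.
  by apply: FQ; exists \top; [exact: (filter_top filP)|exact: leIr].
by move=> u Pu; apply: FQ; exists u => //; exact: leIl.
Qed.

End ExLattice.

(** * Validity of (Ex) in both classes, and the equivalence *)

Lemma ortholattice_Ex d (L : tbLatticeType d) (neg : L -> L) :
  orthocomplemented neg -> Ex_lattice neg.
Proof.
move=> [fneg negK]; split=> // v; cbn [eval Ex fst snd].
move: (v 0%N) (v 1%N) (v 2%N) (v 3%N) (v 4%N) (v 5%N) => a b c d' e f.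
have joinN x : x `|` neg x = \top.
  by rewrite -[LHS]negK (neg_join fneg) negK meetC (meetxN fneg) (neg_bot fneg).
rewrite !negK joinN meetx1 lexI leI2 //=; last first.
  by apply: le_trans (leIl _ _) (leIr _ _).
by apply: le_trans (leIr _ _) (leUr _ _).
Qed.

(** Distributivity rewrites the argument of the first negation as [a] ∧ [x], where [x] is the
    element whose excluded middle is claimed. Then [neg x] holds, because [neg (a ∧ x)] ∧ [a] lies
    below it. *)
Lemma heyting_Ex d (L : tbDistrLatticeType d) (neg : L -> L) :
  heyting neg -> Ex_lattice neg.
Proof.
move=> [fneg pseudo]; split=> // v; cbn [eval Ex fst snd].
move: (v 0%N) (v 1%N) (v 2%N) (v 3%N) (v 4%N) (v 5%N) => a b c d' e f.
have pseudoE x y : (y <= neg x) = (x `&` y == \bot).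
  apply/idP/eqP => [yx|/pseudo //]; apply/eqP; rewrite -lex0 -(meetxN fneg x).
  exact: leI2.
have aNN : a `&` neg (neg f) <= neg (neg (a `&` f)).
  have aN : a `&` neg (a `&` f) <= neg f.
    by rewrite pseudoE meetA [f `&` a]meetC (meetxN fneg).
  rewrite pseudoE meetA [neg _ `&` a]meetC -lex0 -(meetxN fneg (neg f)).
  exact: leI2.
have NI x : neg (a `&` x) `&` a <= neg x.
  by rewrite pseudoE meetC -meetA (meetC (neg _)) (meetxN fneg).
rewrite -!meetUr !lexI -andbA; apply/and3P; split.
- by apply: le_trans aNN; rewrite leI2 // (le_trans (leIl _ _)) ?leIr.
- by apply: le_trans (leUl _ _); rewrite (le_trans (leIl _ _)) // leI2 ?leIr.
- by apply: le_trans (le_trans (NI _) (leUr _ _)); rewrite -[leLHS]meetA leIl.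
Qed.

Theorem theorem5p1 :
  (forall phi psi : formula,
     (valid_ortholattices (phi, psi) /\ valid_heyting_lattices (phi, psi))
     <-> valid_Ex_lattices (phi, psi))
  /\ (orthologic `&` intuitionistic_fragment)%classic = fundamental_logic_Ex.
Proof.
suff main phi psi :
    (valid_ortholattices (phi, psi) /\ valid_heyting_lattices (phi, psi))
    <-> valid_Ex_lattices (phi, psi).
  by split; [exact: main|apply/seteqP; split=> -[phi psi] /main].
split=> [[ortho heyt] d L neg exL v | valEx]; last first.
  split=> d L neg; first by move=> /ortholattice_Ex; exact: valEx.
  by move=> /heyting_Ex; exact: valEx.
have fneg := Ex_fundamental exL; apply: contrapT => /= nle.
(* Validity in the ortholattice of regular elements excludes the first alternative outright, so no
   case distinction is made. *)
have nnle : neg (neg (eval neg v phi)) <= neg (neg (eval neg v psi)).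
  have hom := to_regular_hom fneg (Ex_negneg_meet exL).
  have := ortho _ _ _ (regular_orthocomplemented fneg) (to_regular fneg \o v).
  by rewrite /= -!(eval_hom _ _ hom).
have [P [pP Pphi Ppsi]] :=
  Ex_prime_separation exL (le_trans (le_negneg fneg _) nnle) nle.
have hom := basic_upset_hom (meetxN fneg) (Ex_prime_extension exL).
have := heyt _ _ _ (@upset_heyting _ _) (@basic_upset _ L \o v).
rewrite /= -!(eval_hom _ _ hom) => /upset_leP /(_ (to_spectrum pP)).
by move=> /(_ Pphi).
Qed.
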